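(* Let $f\in\mathbb{R}[x_1,\dots,x_n]$ be a homogeneous polynomial of degree $d$. Write $f^2=\sum a\cdot x^\mu$, the sum being over the terms $a\cdot x^\mu$ of $f^2$ (with $a\in\mathbb{R}$ the coefficient and $\mu\in\mathbb{Z}_{\ge0}^n$ the exponent vector). Then $$\operatorname{Cov}(f)=\frac{\pi^{n/2}}{2^d\,\Gamma(n/2+d+1)}\cdot\sum a\cdot\Psi(x^\mu),$$ where $\Psi(x^\mu)\in\mathbb{Z}_{\ge0}^{n\times n}$ is given by $$\Psi(x^\mu)=\left(\prod_{k=1}^n\eta(\mu_k)!!\right)\begin{cases}\operatorname{diag}(\mu)+I_n,&\text{if }\mu\text{ has no odd entries},\\ e_ue_v^\top+e_ve_u^\top,&\text{if }\mu\text{ has exactly two odd entries, at indices }u\neq v,\\ 0_{n\times n},&\text{otherwise}.\end{cases}$$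
   Context: For a homogeneous polynomial $f\in\mathbb{R}[x_1,\dots,x_n]$, the polynomial-weighted covariance matrix is $\operatorname{Cov}(f)=\int_{\mathbb{S}^{n-1}}f(x)^2\,xx^\top\,d\mu(x)\in\mathbb{R}^{n\times n}$, where here $\mu$ denotes the (unnormalized surface) spherical measure on the unit sphere $\mathbb{S}^{n-1}\subset\mathbb{R}^n$ (not to be confused with the exponent vector $\mu$ in the claim). $\Gamma$ is the gamma function; $!!$ is the double factorial, with $(-1)!!=1$; $e_i$ is the $i$-th standard basis vector of $\mathbb{R}^n$; $\eta(s)=s$ if $s$ is odd and $\eta(s)=s-1$ if $s$ is even. *)

(* Defs.v *)
From HB Require Import structures.
From mathcomp Require Import all_boot all_order all_algebra.
(* The notations of mpoly clash with those of MathComp-Analysis. *)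
From mathcomp.multinomials Require Export -(notations) mpoly.
From mathcomp Require Import all_classical all_reals all_analysis measurable_realfun.

Set Implicit Arguments.
Unset Strict Implicit.
Unset Printing Implicit Defensive.
Import Order.TTheory GRing.Theory Num.Theory.

Local Open Scope classical_set_scope.
Local Open Scope ring_scope.

(* Points of R^n are n-tuples, which carry the product sigma-algebra. *)

Section lebesgue_tupleS.
Context (R : realType) (n : nat).
Variable m : {sigma_finite_measure set (n.-tuple R) -> \bar R}.

Definition tuple_cons (p : R * n.-tuple R) : n.+1.-tuple R :=
  [the n.+1.-tuple R of p.1 :: p.2].

Lemma measurable_tuple_cons : measurable_fun setT tuple_cons.
Proof. exact: measurable_cons. Qed.

Definition lebesgue_tupleS : set (n.+1.-tuple R) -> \bar R :=
  pushforward (lebesgue_measure \x m)%E tuple_cons.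

Let lebesgue_tupleS0 : lebesgue_tupleS set0 = 0%E.
Proof. by rewrite /lebesgue_tupleS /pushforward preimage_set0 measure0. Qed.

Let lebesgue_tupleS_ge0 A : (0 <= lebesgue_tupleS A)%E.
Proof. exact: integral_ge0. Qed.

Let lebesgue_tupleS_sigma_additive : semi_sigma_additive lebesgue_tupleS.
Proof.
have mc A : measurable A -> measurable (tuple_cons @^-1` A).
  by move=> mA; rewrite -[X in measurable X]setTI; exact: measurable_tuple_cons.
move=> F mF tF mUF; rewrite /lebesgue_tupleS /pushforward preimage_bigcup.
apply: measure_semi_sigma_additive => [i| |]; first exact: mc.
- apply/trivIsetP => /= i j _ _ ij; rewrite -preimage_setI.
  by move/trivIsetP : tF => /(_ _ _ _ _ ij) ->//; rewrite preimage_set0.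
- by rewrite -preimage_bigcup; exact: mc.
Qed.

HB.instance Definition _ := isMeasure.Build _ _ _ lebesgue_tupleS
  lebesgue_tupleS0 lebesgue_tupleS_ge0 lebesgue_tupleS_sigma_additive.

Let lebesgue_tupleS_sigma_finite : sigma_finite setT lebesgue_tupleS.
Proof.
have /sigma_finiteP[F [TF ndF Foo]] := sigma_finiteT (@lebesgue_measure R).
have /sigma_finiteP[G [TG ndG Goo]] := sigma_finiteT m.
pose uncons (t : n.+1.-tuple R) : measurableTypeR R * n.-tuple R :=
  (thead t, [tuple of behead t]).
have consK p : uncons (tuple_cons p) = p.
  by case: p => x t; congr (_, _); exact: val_inj.
have muncons : measurable_fun setT uncons.
  apply/measurable_fun_pairP; split.
    exact: measurable_tnth.
  exact: measurable_behead.
exists (fun i => uncons @^-1` (F i `*` G i)).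
  apply/seteqP; split => // t _.
  have [i _ Fit] : (\bigcup_i F i) (thead t) by rewrite -TF.
  have [j _ Gjt] : (\bigcup_j G j) [tuple of behead t] by rewrite -TG.
  exists (maxn i j) => //; split => /=.
    by move: Fit; exact/subsetPset/ndF/leq_maxl.
  by move: Gjt; exact/subsetPset/ndG/leq_maxr.
move=> i; have [mFi Fioo] := Foo i; have [mGi Gioo] := Goo i; split.
  by rewrite -[X in measurable X]setTI; apply: muncons => //; exact: measurableX.
rewrite /lebesgue_tupleS /pushforward.
rewrite (_ : _ @^-1` _ = F i `*` G i); last first.
  by apply/funext => p; rewrite -[in RHS](consK p).
by rewrite product_measure1E// lte_mul_pinfty// ge0_fin_numE.
Qed.

HB.instance Definition _ := Measure_isSigmaFinite.Build _ _ _ lebesgue_tupleS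
  lebesgue_tupleS_sigma_finite.

End lebesgue_tupleS.

Fixpoint lebesgue_tuple (R : realType) (n : nat) :
    {sigma_finite_measure set (n.-tuple R) -> \bar R} :=
  match n with
  | 0 => [the {sigma_finite_measure set (0.-tuple R) -> \bar R} of \d_[tuple]]
  | n'.+1 => [the {sigma_finite_measure set (n'.+1.-tuple R) -> \bar R} of
               lebesgue_tupleS (lebesgue_tuple R n')]
  end.

Section surface_measure.
Context (R : realType) (n : nat).
Implicit Types (x y : n.-tuple R) (A : set (n.-tuple R)).

Definition euclidean_norm x : R := Num.sqrt (\sum_(i < n) tnth x i ^+ 2).

Definition sphere : set (n.-tuple R) := [set x | euclidean_norm x = 1].

Definition scale_tuple (t : R) x : n.-tuple R := [tuple t * tnth x i | i < n].

Definition cone A : set (n.-tuple R) :=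
  [set scale_tuple t x | t in `]0, 1]%classic & x in A].

(* The surface measure: the area of a part of the sphere is n times the volume *)
(* of the cone over it, as obtained by integrating t^(n-1) over ]0, 1].        *)
Definition surface_measure A : \bar R :=
  (n%:R%:E * lebesgue_tuple R n (cone (A `&` sphere)))%E.

Lemma norm_ge0 x : 0 <= euclidean_norm x.
Proof. exact: sqrtr_ge0. Qed.

Lemma norm_scale t x : 0 <= t ->
  euclidean_norm (scale_tuple t x) = t * euclidean_norm x.
Proof.
move=> t0; rewrite /euclidean_norm.
under eq_bigr do rewrite tnth_mktuple exprMn.
by rewrite -mulr_sumr sqrtrM ?sqr_ge0// sqrtr_sqr ger0_norm.
Qed.

Lemma scale_tupleA s t x : scale_tuple s (scale_tuple t x) = scale_tuple (s * t) x.
Proof. by apply: eq_from_tnth => i; rewrite !tnth_mktuple mulrA. Qed.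

Lemma scale_tuple1 x : scale_tuple 1 x = x.
Proof. by apply: eq_from_tnth => i; rewrite !tnth_mktuple mul1r. Qed.

Let radial x := scale_tuple (euclidean_norm x `^ (-1)) x.

Lemma cone_sphereE A : cone (A `&` sphere) =
  euclidean_norm @^-1` `]0, 1] `&` radial @^-1` A.
Proof.
apply/seteqP; split => [_ [t /= + [x [Ax Sx] <-]]|x /= []].
  rewrite in_itv/= => /andP[t0 t1]; split => /=.
    by rewrite norm_scale ?ltW// Sx mulr1 in_itv/= t0.
  rewrite /radial scale_tupleA norm_scale ?ltW// Sx mulr1.
  by rewrite powR_inv1 ?ltW// mulVf ?gt_eqF// scale_tuple1.
rewrite in_itv/= => /andP[x0 x1]; rewrite /radial powR_inv1 ?norm_ge0// => Ax.
exists (euclidean_norm x); first by rewrite /= in_itv/= x0.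
exists (scale_tuple (euclidean_norm x)^-1 x).
  by split=> //; rewrite /sphere/= norm_scale ?invr_ge0 ?norm_ge0// mulVf ?gt_eqF.
by rewrite scale_tupleA mulfV ?gt_eqF// scale_tuple1.
Qed.

Lemma measurable_euclidean_norm : measurable_fun setT euclidean_norm.
Proof.
apply: (measurableT_comp (continuous_measurable_fun (@sqrt_continuous R))).
apply: measurable_sum => i; apply: measurable_funX; exact: measurable_tnth.
Qed.

Let measurable_radial : measurable_fun setT radial.
Proof.
apply/measurable_fun_tnthP => i.
rewrite (_ : _ \o _ = fun x => euclidean_norm x `^ (-1) * tnth x i); last first.
  by apply/funext => x /=; rewrite tnth_mktuple.
apply: measurable_funM; last exact: measurable_tnth.
exact: (measurableT_comp (measurable_powR _) measurable_euclidean_norm).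
Qed.

Lemma measurable_sphere : measurable sphere.
Proof.
rewrite (_ : sphere = setT `&` euclidean_norm @^-1` [set 1]); last first.
  by rewrite setTI.
exact: measurable_euclidean_norm.
Qed.

Lemma measurable_cone_sphere A : measurable A -> measurable (cone (A `&` sphere)).
Proof.
move=> mA; rewrite cone_sphereE; apply: measurableI.
  by rewrite -[X in measurable X]setTI; exact: measurable_euclidean_norm.
by rewrite -[X in measurable X]setTI; exact: measurable_radial.
Qed.

Let surface_measure0 : surface_measure set0 = 0%E.
Proof.
rewrite /surface_measure cone_sphereE preimage_set0 setI0.
by rewrite measure0 mule0.
Qed.

Let surface_measure_ge0 A : (0 <= surface_measure A)%E.
Proof. by rewrite /surface_measure mule_ge0// lee_fin. Qed.

Let surface_measure_sigma_additive : semi_sigma_additive surface_measure.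
Proof.
move=> F mF tF mUF; rewrite /surface_measure.
rewrite (_ : (fun k => _) = (fun k => n%:R%:E *
    \sum_(0 <= i < k) lebesgue_tuple R n (cone (F i `&` sphere)))%E); last first.
  by apply/funext => k; rewrite ge0_sume_distrr.
apply: cvgeZl => //.
rewrite cone_sphereE preimage_bigcup setI_bigcupr.
under eq_fun do under eq_bigr do rewrite cone_sphereE.
apply: measure_semi_sigma_additive => [i| |].
- by rewrite -cone_sphereE; exact: measurable_cone_sphere.
- apply/trivIsetP => /= i j _ _ ij; rewrite setIACA setIid -preimage_setI.
  by move/trivIsetP : tF => /(_ _ _ _ _ ij) ->//; rewrite preimage_set0 setI0.
- rewrite -setI_bigcupr -preimage_bigcup -cone_sphereE.
  exact: measurable_cone_sphere.
Qed.

HB.instance Definition _ := isMeasure.Build _ _ _ surface_measure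
  surface_measure0 surface_measure_ge0 surface_measure_sigma_additive.

End surface_measure.

Arguments sphere : clear implicits.
Arguments surface_measure : clear implicits.

Definition Gamma (R : realType) (s : R) : R :=
  \int[lebesgue_measure]_(t in `]0, +oo[) (t `^ (s - 1) * expR (- t)).

Definition cov (R : realType) (n : nat) (f : mpoly n R) : 'M[R]_n :=
  \matrix_(i, j) \int[surface_measure R n]_(x in sphere R n)
    (meval (tnth x) f ^+ 2 * (tnth x i * tnth x j)).

Definition eta (s : nat) : int := if odd s then s%:Z else s%:Z - 1.

Fixpoint double_fact_nat (k : nat) : nat :=
  if k is k'.+2 then (k * double_fact_nat k')%N else 1%N.

(* Only -1 is relevant among the negative integers. *)
Definition double_fact (k : int) : nat :=
  if k is Posz k' then double_fact_nat k' else 1%N.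

Definition basis_vec (n : nat) (i : 'I_n) : 'cV[nat]_n := delta_mx i 0.

Definition Psi (n : nat) (mu : multinom n) : 'M[nat]_n :=
  (\prod_(k < n) double_fact (eta (mu k)))%N *:
  match enum [pred k | odd (mu k)] with
  | [::] => diag_mx (\row_k mu k) + 1%:M
  | [:: u; v] => basis_vec u *m (basis_vec v)^T + basis_vec v *m (basis_vec u)^T
  | _ => 0
  end.

(* Main.v *)
(* By Tonelli and scaling, a nonnegative Q, homogeneous of degree m > 0,       *)
(* satisfies the polar formula                                                *)
(*   int_(R^n) Q(x) exp(-|x|^2) dx                                            *)
(*     = (int_0^oo r^(n+m-1) exp(-r^2) dr) * int_(S^(n-1)) Q.                 *)
(* For Q = |x^nu| the left-hand side is a product of one-dimensional Gaussian *)
(* moments, which gives the sphere integrals of the monomials with even       *)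
(* exponents; the ones with an odd exponent vanish by reflecting that         *)
(* coordinate. The (i, j) entry of Cov(f) is the sum of a * int x^nu with     *)
(* nu = mu + e_i + e_j, and Psi(x^mu)_(i,j) is the product of (nu_k - 1)!!    *)
(* when nu has only even entries and 0 otherwise.                             *)
Require Import Defs.
From mathcomp Require Import all_boot all_order all_algebra ring lra zify.
From mathcomp Require Import all_classical all_reals all_analysis.
From mathcomp Require Import measurable_realfun.
Import Order.TTheory GRing.Theory Num.Theory.
Import numFieldNormedType.Exports.
Local Open Scope classical_set_scope.
Local Open Scope ring_scope.

(** The surface measure is given through volumes of cones, so the monomial integrals over the sphere
    are extracted from Gaussian integrals over R^n. [ge0_polar_gauss] splits the Gaussian integral
    of a nonnegative homogeneous Q into a radial moment times the surface integral of Q. Since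
    exp(-|x|^2) factors over the coordinates, Q = |x^nu| turns the left side into a product of
    one-dimensional moments ([integral_sphere_norm_monomial]). For nu even of degree 2d+2 that
    product is pi^(n/2) 2^-(d+1) times the product of the (nu_k - 1)!!, while the radial moment of
    order n+2d+1 is Gamma(n/2+d+1)/2 ([Gamma_half]); the quotient yields the constant of the theorem
    ([Rintegral_sphere_monomial]). [Rintegral_sphere_odd] settles odd exponents. [Psi_entry] matches
    the entries of Psi(x^mu) with nu = mu + e_i + e_j, and linearity over the terms of f^2
    concludes. *)

(** * Scaling of one-dimensional Lebesgue measure *)

Section lebesgue_scale.
Context {R : realType}.
Local Notation mu := (@lebesgue_measure R).
Implicit Types (a : R) (g : R -> \bar R).

Let scale_mfun a : measurableTypeR R -> measurableTypeR R := *%R a.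

Let measurable_scale a : measurable_fun setT (scale_mfun a).
Proof. exact: mulrl_measurable. Qed.

(** By uniqueness of Lebesgue measure: a times the image measure gives half-open intervals their
    length. *)
Lemma lebesgue_measure_scale a (A : set R) : 0 < a -> measurable A ->
  pushforward mu ( *%R a : measurableTypeR R -> measurableTypeR R) A = (a^-1%:E * mu A)%E.
Proof.
move=> a0 mA; have am0 : 0 <= a by exact: ltW.
pose am : {nonneg R} := NngNum am0.
pose push : {measure set (measurableTypeR R) -> \bar R} :=
  pushforward mu (scale_mfun a).
pose nu : {measure set (measurableTypeR R) -> \bar R} :=
  mscale am (push (measurable_scale a)).
rewrite (@lebesgue_measure_unique R nu)//.
  by rewrite /nu/= /mscale/= muleA -EFinM mulVf ?gt_eqF// mul1e.
move=> X /ocitvP[->|[[x y] /= xy ->]]; first by rewrite !measure0.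
rewrite /nu/= /mscale/= /pushforward (_ : _ @^-1` _ = `]x / a, y / a]%classic).
  rewrite !lebesgue_measure_itv/= !lte_fin ltr_pM2r ?invr_gt0// xy.
  by rewrite -!EFinB -mulrBl -EFinM mulrCA mulfV ?gt_eqF// mulr1.
apply/seteqP; split => z /=; rewrite !in_itv/= ltr_pdivrMr// ler_pdivlMr//;
  by rewrite mulrC.
Qed.

Lemma ge0_integral_oppr g : measurable_fun setT g -> (forall x, 0 <= g x)%E ->
  (\int[mu]_x g (- x)%R = \int[mu]_x g x)%E.
Proof.
move=> mg g0.
have := @ge0_integral_pushforward _ _ (measurableTypeR R) (measurableTypeR R) R
  -%R (@oppr_measurable R setT) mu setT g.
rewrite preimage_setT => <-//.
by apply: eq_measure_integral => A mA _; exact: lebesgue_measureN.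
Qed.

Let ge0_integral_scale_gt0 a g : 0 < a ->
  measurable_fun setT g -> (forall x, 0 <= g x)%E ->
  (\int[mu]_x g (a * x)%R = a^-1%:E * \int[mu]_x g x)%E.
Proof.
move=> a0 mg g0; have a0' : 0 <= a^-1 by rewrite invr_ge0 ltW.
have := @ge0_integral_pushforward _ _ _ _ R _ (measurable_scale a) mu setT g.
rewrite preimage_setT => <-//.
rewrite -(@ge0_integral_mscale _ _ _ mu setT _ (NngNum a0'))//.
by apply: eq_measure_integral => A mA _; exact: lebesgue_measure_scale.
Qed.

Lemma ge0_integral_scale a g : a != 0 ->
  measurable_fun setT g -> (forall x, 0 <= g x)%E ->
  (\int[mu]_x g (a * x)%R = `|a|^-1%:E * \int[mu]_x g x)%E.
Proof.
move=> an0 mg g0; have [a0|a0] := ltP 0 a.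
  by rewrite gtr0_norm// ge0_integral_scale_gt0.
have {an0} a0 : a < 0 by rewrite lt_neqAle an0.
rewrite -(ge0_integral_oppr g mg g0) ltr0_norm//.
rewrite -(@ge0_integral_scale_gt0 _ (fun x => g (- x)%R)) ?oppr_gt0//.
  by under [RHS]eq_integral do rewrite mulNr opprK.
by apply: measurableT_comp => //; exact: oppr_measurable.
Qed.

End lebesgue_scale.

(** * Tonelli and scaling on tuples *)

Section lebesgue_tuple_tonelli.
Context {R : realType}.
Local Notation mu := (@lebesgue_measure R).
Local Notation leb := (lebesgue_tuple R).

Lemma tnth_tuple_cons0 n (p : R * n.-tuple R) : tnth (tuple_cons p) ord0 = p.1.
Proof. by []. Qed.

Lemma tnth_tuple_consS n (p : R * n.-tuple R) (i : 'I_n) :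
  tnth (tuple_cons p) (lift ord0 i) = tnth p.2 i.
Proof. by rewrite tnthS; congr tnth; exact: val_inj. Qed.

Lemma ge0_integral_lebesgue_tupleS n (g : n.+1.-tuple R -> \bar R) :
  measurable_fun setT g -> (forall x, 0 <= g x)%E ->
  (\int[leb n.+1]_x g x = \int[mu]_x \int[leb n]_t g (tuple_cons (x, t)))%E.
Proof.
move=> mg g0.
have := @ge0_integral_pushforward _ _ (measurableTypeR R * n.-tuple R)%type
  (n.+1.-tuple R) R _ (@measurable_tuple_cons R n)
  (mu \x leb n)%E setT g.
rewrite preimage_setT => /(_ measurableT mg (fun x _ => g0 x)) gE.
transitivity (\int[mu \x leb n]_x (g \o @tuple_cons R n) x)%E.
  by rewrite -gE; apply: (eq_measure_integral (lebesgue_tupleS (leb n))).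
rewrite fubini_tonelli1//; last by move=> x; exact: g0.
exact: (measurableT_comp mg (@measurable_tuple_cons R n)).
Qed.

(** One factor per coordinate covers both uses: dilations, with [a] constant, and the reflection of
    a single coordinate. *)
Definition scale_coords n (a : 'I_n -> R) (x : n.-tuple R) : n.-tuple R :=
  [tuple a i * tnth x i | i < n].

Lemma measurable_scale_coords n (a : 'I_n -> R) :
  measurable_fun setT (scale_coords n a).
Proof.
apply/measurable_fun_tnthP => i.
rewrite (_ : _ \o _ = fun x => a i * tnth x i); last first.
  by apply/funext => x /=; rewrite tnth_mktuple.
by apply: measurable_funM => //; exact: measurable_tnth.
Qed.

Lemma ge0_integral_scale_coords n (a : 'I_n -> R) (g : n.-tuple R -> \bar R) :
  (forall i, a i != 0) -> measurable_fun setT g -> (forall x, 0 <= g x)%E ->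
  (\int[leb n]_x g (scale_coords n a x)
   = (\prod_(i < n) `|a i|^-1)%:E * \int[leb n]_x g x)%E.
Proof.
elim: n a g => [|n ih] a g a0 mg g0.
  rewrite big_ord0 mul1e; apply: eq_integral => x _.
  by congr g; apply: eq_from_tnth => -[].
rewrite ge0_integral_lebesgue_tupleS//; last first.
  by apply: measurableT_comp => //; exact: measurable_scale_coords.
have consE x t : scale_coords n.+1 a (tuple_cons (x, t)) =
    tuple_cons (a ord0 * x, scale_coords n (a \o lift ord0) t).
  apply: eq_from_tnth => i; rewrite tnth_mktuple.
  case: (unliftP ord0 i) => [j ->|->]; last by rewrite !tnth_tuple_cons0.
  by rewrite !tnth_tuple_consS/= tnth_mktuple.
have mgc : measurable_fun setT (g \o @tuple_cons R n).
  exact: (measurableT_comp mg (@measurable_tuple_cons R n)).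
have mg1 x : measurable_fun setT (fun t => g (tuple_cons (x, t))).
  exact: (measurableT_comp mgc (measurable_pair1 x)).
under eq_integral do under eq_integral do rewrite consE.
pose c := (\prod_(i < n) `|(a \o lift ord0) i|^-1)%:E.
have ihx (y : R) : (\int[leb n]_t g (tuple_cons (y, scale_coords n (a \o lift ord0) t))
    = c * \int[leb n]_t g (tuple_cons (y, t)))%E.
  exact: (ih _ (fun t => g (tuple_cons (y, t))) (fun i => a0 _) (mg1 _)).
under eq_integral do rewrite ihx.
pose G (x : R) := (\int[leb n]_t g (tuple_cons (x, t)))%E.
have mG : measurable_fun setT G.
  exact: (@measurable_fun_fubini_tonelli_F _ _ _ _ R (leb n) _ mgc (fun x => g0 _)).
have G0 x : (0 <= G x)%E by exact: integral_ge0.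
have c0 : (0 <= c)%E.
  by rewrite lee_fin; apply: prodr_ge0 => i _; rewrite invr_ge0.
rewrite ge0_integralZl//; last 2 first.
- exact: (measurableT_comp mG (@mulrl_measurable _ _ (a ord0))).
- by move=> x _; exact: G0.
rewrite (@ge0_integral_scale R (a ord0) G)// -ge0_integral_lebesgue_tupleS//.
by rewrite muleA -EFinM big_ord_recl mulrC.
Qed.

Lemma ge0_integral_lebesgue_tuple_prod n (g : 'I_n -> R -> R) (c : 'I_n -> R) :
  (forall i, measurable_fun setT (g i)) -> (forall i x, 0 <= g i x) ->
  (forall i, \int[mu]_x (g i x)%:E = (c i)%:E)%E ->
  (\int[leb n]_x (\prod_(i < n) g i (tnth x i))%:E = (\prod_(i < n) c i)%:E)%E.
Proof.
elim: n g c => [|n ih] g c mg g0 gc.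
  (* In dimension 0 the measure is a Dirac mass, so the empty product integrates to 1. *)
  under eq_integral do rewrite big_ord0.
  by rewrite big_ord0 integral_cst//= diracE in_setT mul1e.
rewrite ge0_integral_lebesgue_tupleS; last 2 first.
- apply/measurable_EFinP; apply: measurable_prod => i _.
  by apply: measurableT_comp => //; exact: measurable_tnth.
- by move=> x; rewrite lee_fin; exact: prodr_ge0.
transitivity (\int[mu]_x ((\prod_(i < n) c (lift ord0 i))%:E * (g ord0 x)%:E))%E.
  apply: eq_integral => x _.
  under eq_integral.
    move=> t _; rewrite big_ord_recl tnth_tuple_cons0/=.
    under eq_bigr do rewrite tnth_tuple_consS/=.
    rewrite EFinM; over.
  rewrite ge0_integralZl//=.
  - by rewrite (ih (fun i => g (lift ord0 i)) (fun i => c (lift ord0 i)))// muleC.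
  - apply/measurable_EFinP; apply: measurable_prod => i _.
    by apply: measurableT_comp => //; exact: measurable_tnth.
  - by move=> t _; rewrite lee_fin; exact: prodr_ge0.
  - by rewrite lee_fin.
have c0 i : 0 <= c i by rewrite -lee_fin -gc integral_ge0// => x _; rewrite lee_fin.
have mg0 : measurable_fun setT (EFin \o g ord0) by exact/measurable_EFinP.
rewrite ge0_integralZl//.
- by rewrite gc -EFinM big_ord_recl mulrC.
- by move=> x _; rewrite lee_fin.
- by rewrite lee_fin; exact: prodr_ge0.
Qed.

End lebesgue_tuple_tonelli.

(** * Integrals over half lines *)

Section half_line_integrals.
Context {R : realType}.
Local Notation mu := (@lebesgue_measure R).

Lemma integral_mkcond_if d (T : measurableType d)
    (m : {measure set T -> \bar R}) (P : T -> bool) (f : T -> \bar R) :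
  (\int[m]_(x in [set x | P x]) f x = \int[m]_x (if P x then f x else 0))%E.
Proof.
rewrite integral_mkcond; apply: eq_integral => x _; rewrite patchE.
by case: ifPn => [/set_mem/= ->//|/negP xP]; rewrite ifN//; apply/negP => Px;
  apply: xP; apply/mem_set.
Qed.

(** Both sides integrate a(x) b(s) over the region 0 <= x <= s, in the two orders allowed by
    Tonelli. This serves as integration by parts without boundary terms at infinity. *)
Lemma ge0_integral_triangle (a b : R -> R) :
  measurable_fun setT a -> measurable_fun setT b ->
  (forall x, 0 <= x -> 0 <= a x) -> (forall x, 0 <= x -> 0 <= b x) ->
  (\int[mu]_(x in `[0%R, +oo[) ((a x)%:E * \int[mu]_(s in `[x, +oo[) (b s)%:E)
   = \int[mu]_(s in `[0%R, +oo[) ((b s)%:E * \int[mu]_(x in `[0%R, s]) (a x)%:E))%E.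
Proof.
move=> ma mb a0 b0.
pose Phi (p : measurableTypeR R * measurableTypeR R) : \bar R :=
  (if (0 <= p.1) && (p.1 <= p.2) then (a p.1 * b p.2) else 0)%:E.
have itvE (x y : R) : (y \in `[x, +oo[) = (x <= y) by rewrite in_itv/= andbT.
have Phi0 p : (0 <= Phi p)%E.
  rewrite lee_fin /Phi; case: ifPn => // /andP[p0 p12].
  by rewrite mulr_ge0 ?a0 ?b0// (le_trans p0).
have mfst : measurable_fun setT (fun p : measurableTypeR R * measurableTypeR R => p.1 : R).
  exact: measurable_fst.
have msnd : measurable_fun setT (fun p : measurableTypeR R * measurableTypeR R => p.2 : R).
  exact: measurable_snd.
have mPhi : measurable_fun setT Phi.
  apply/measurable_EFinP; apply: measurable_fun_ifT; last exact: measurable_cst.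
    apply: measurable_and; apply: measurable_fun_ler => //; exact: measurable_cst.
  apply: measurable_funM.
    exact: (measurableT_comp ma mfst).
  exact: (measurableT_comp mb msnd).
transitivity (\int[mu]_x \int[mu]_s Phi (x, s))%E.
  rewrite integral_mkcond_if; apply: eq_integral => x _.
  rewrite itvE; case: ifPn => x0; last first.
    under eq_integral do rewrite /Phi/= (negbTE x0)/=.
    by rewrite integral0.
  under [RHS]eq_integral do rewrite /Phi/= x0/=.
  rewrite -ge0_integralZl//; last 3 first.
  - exact/measurable_EFinP/measurable_funTS.
  - move=> s/=; rewrite itvE lee_fin => xs; exact/b0/(le_trans x0).
  - by rewrite lee_fin a0.
  rewrite integral_mkcond_if; apply: eq_integral => s _.
  by rewrite itvE; case: ifP.
rewrite (fubini_tonelli Phi mPhi Phi0).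
rewrite [RHS]integral_mkcond_if; apply: eq_integral => s _.
rewrite itvE; case: ifPn => s0; last first.
  apply: integral0_eq => x _; rewrite /Phi/= ifF//.
  by apply/negbTE; apply: contra s0 => /andP[]; exact: le_trans.
rewrite -ge0_integralZl//; last 3 first.
- exact/measurable_EFinP/measurable_funTS.
- by move=> x/=; rewrite in_itv/= lee_fin => /andP[x0 _]; exact: a0.
- by rewrite lee_fin b0.
rewrite [RHS]integral_mkcond_if; apply: eq_integral => x _.
by rewrite in_itv/= /Phi/=; case: ifP => //; rewrite mulrC EFinM.
Qed.

Lemma is_derive_exprS k (x : R) :
  is_derive x 1 (fun y : R => y ^+ k.+1) (k.+1%:R * x ^+ k).
Proof.
have := @is_deriveX R R id k.+1 x 1 1 (is_derive_id _ _).
by rewrite /GRing.scale/= mulr1 exprfctE.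
Qed.

Lemma integral_itv0_expr k (s : R) : 0 <= s ->
  (\int[mu]_(x in `[0%R, s]) (k.+1%:R * x ^+ k)%:E = (s ^+ k.+1)%:E)%E.
Proof.
rewrite le_eqVlt => /predU1P[<-|s0].
  by rewrite set_itv1 integral_set1 expr0n.
have dX x := is_derive_exprS k x.
have cX : continuous (fun x : R => x ^+ k.+1) by exact: exprn_continuous.
rewrite (@continuous_FTC2 _ _ (fun x => x ^+ k.+1))//.
- by rewrite expr0n/= sube0.
- apply: continuous_subspaceT => x; apply: cvgM; first exact: cvg_cst.
  exact: exprn_continuous.
- split => [x _| |].
  + by have := dX x; case.
  + exact/cvg_at_right_filter/cX.
  + exact/cvg_at_left_filter/cX.
- by move=> x _; rewrite derive1E derive_val.
Qed.

(** The antiderivative is [- gauss_fun], which vanishes at infinity. The case r = 0 also yields the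
    first moment. *)
Lemma integral_gauss_tail (r : R) : 0 <= r ->
  (\int[mu]_(s in `[r, +oo[) (2 * s * gauss_fun s)%:E = (gauss_fun r)%:E)%E.
Proof.
move=> r0.
have dG (x : R) : is_derive x 1 (fun x => - gauss_fun x) (2 * x * gauss_fun x).
  have d1 : is_derive x 1 (fun y : R => - y ^+ 2) (- (2 * x)).
    exact/is_deriveN/(is_derive_exprS 1).
  have := @is_derive1_comp R expR (fun y : R => - y ^+ 2) x _ _ (is_derive_expR _) d1.
  move=> /is_deriveN; rewrite /gauss_fun mulrN opprK mulrC; exact.
have cG : continuous (fun x : R => - gauss_fun x).
  by move=> x; apply: cvgN; exact: continuous_gauss_fun.
rewrite (@ge0_continuous_FTC2y _ _ (fun x => - gauss_fun x) _ 0).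
- by rewrite EFinN oppeK add0e.
- by move=> x rx; rewrite !mulr_ge0 ?gauss_fun_ge0// (le_trans r0).
- apply: continuous_subspaceT => x; apply: cvgM; last exact: continuous_gauss_fun.
  by apply: cvgM; [exact: cvg_cst|exact: cvg_id].
- by rewrite -oppr0; apply: cvgN; exact: cvg_gauss_fun.
- by move=> x _; have := dG x; case.
- exact/cvg_at_right_filter/cG.
- by move=> x _; rewrite derive1E derive_val.
Qed.

End half_line_integrals.

(** * Gaussian moments and the gamma function *)

Section gauss_moments.
Context {R : realType}.
Local Notation mu := (@lebesgue_measure R).

(** Closed form of the integral of x^k exp(-x^2) over [0, +oo[; the two-step recursion is
    integration by parts. *)
Fixpoint half_gauss_moment (k : nat) : R :=
  match k with
  | 0 => Num.sqrt pi / 2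
  | 1 => 1 / 2
  | k'.+2 => k'.+1%:R / 2 * half_gauss_moment k'
  end.

Lemma half_gauss_moment_gt0 k : 0 < half_gauss_moment k.
Proof.
suff: (0 < half_gauss_moment k) && (0 < half_gauss_moment k.+1) by case/andP.
elim: k => [|k /andP[k0 k1]]; first by rewrite !divr_gt0// sqrtr_gt0 pi_gt0.
by rewrite k1/= mulr_gt0// divr_gt0// ltr0n.
Qed.

Lemma measurable_exprM_gauss k :
  measurable_fun setT (fun x : R => x ^+ k * gauss_fun x).
Proof. by apply: measurable_funM => //; exact: measurable_gauss_fun. Qed.

Lemma integral_half_gauss_moment k :
  (\int[mu]_(x in `[0%R, +oo[) (x ^+ k * gauss_fun x)%:E
   = (half_gauss_moment k)%:E)%E.
Proof.
have mxg := measurable_exprM_gauss.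
have mxge j (D : set R) : measurable_fun D (fun x => (x ^+ j * gauss_fun x)%:E).
  by apply/measurable_EFinP/measurable_funTS; exact: mxg.
have xg0 j (x : R) : 0 <= x -> 0 <= x ^+ j * gauss_fun x.
  by move=> x0; rewrite mulr_ge0 ?exprn_ge0// gauss_fun_ge0.
have itv0 (x : R) : `[0%R, +oo[%classic x -> 0 <= x by rewrite /= in_itv/= andbT.
(* Layer-cake form of integration by parts: write gauss_fun x as the integral *)
(* of 2 s gauss_fun s over s >= x.                                            *)
have rec j : (j.+1%:R%:E * \int[mu]_(x in `[0%R, +oo[) (x ^+ j * gauss_fun x)%:E =
    2%:E * \int[mu]_(x in `[0%R, +oo[) (x ^+ j.+2 * gauss_fun x)%:E)%E.
  have mulZ c i : 0 <= c -> (c%:E * \int[mu]_(x in `[0%R, +oo[) (x ^+ i * gauss_fun x)%:E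
      = \int[mu]_(x in `[0%R, +oo[) (c * (x ^+ i * gauss_fun x))%:E)%E.
    move=> c0; under [RHS]eq_integral do rewrite EFinM.
    rewrite ge0_integralZl//; first exact: mxge.
    by move=> x /itv0 x0; rewrite lee_fin xg0.
  rewrite !mulZ//.
  transitivity (\int[mu]_(x in `[0%R, +oo[) ((j.+1%:R * x ^+ j)%:E *
      \int[mu]_(s in `[x, +oo[) (2 * s * gauss_fun s)%:E))%E.
    apply: eq_integral => x; rewrite inE => /itv0 x0.
    by rewrite integral_gauss_tail// -!EFinM mulrA.
  rewrite ge0_integral_triangle.
  - apply: eq_integral => x; rewrite inE => /itv0 x0.
    by rewrite integral_itv0_expr// -!EFinM !exprS; congr EFin; ring.
  - exact: measurable_funM.
  - apply: measurable_funM; last exact: measurable_gauss_fun.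
    exact: measurable_funM.
  - by move=> x x0; rewrite mulr_ge0// exprn_ge0.
  - by move=> x x0; rewrite !mulr_ge0// gauss_fun_ge0.
have m1 : (\int[mu]_(x in `[0%R, +oo[) (x ^+ 1 * gauss_fun x)%:E = (1/2)%:E)%E.
  have := @integral_gauss_tail R 0 (lexx _).
  under eq_integral do rewrite -mulrA EFinM.
  rewrite ge0_integralZl//; last 2 first.
  - exact: (mxge 1).
  - by move=> x /itv0 x0; rewrite lee_fin (xg0 1).
  rewrite /gauss_fun expr0n oppr0 expR0 => /(congr1 (mule 2^-1%:E)).
  by rewrite muleA -EFinM mulVf// mul1e mule1 mul1r.
have m0 : (\int[mu]_(x in `[0%R, +oo[) (x ^+ 0 * gauss_fun x)%:E =
    (Num.sqrt pi / 2)%:E)%E.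
  by under eq_integral do rewrite mul1r; exact: integral0y_gauss.
(* The recursion advances by two, so consecutive moments are proved together. *)
suff: (\int[mu]_(x in `[0%R, +oo[) (x ^+ k * gauss_fun x)%:E
      = (half_gauss_moment k)%:E)%E /\
    (\int[mu]_(x in `[0%R, +oo[) (x ^+ k.+1 * gauss_fun x)%:E
      = (half_gauss_moment k.+1)%:E)%E by case.
elim: k => [//|k [mk mk1]]; split=> //.
have := rec k; rewrite mk => /(congr1 (mule 2^-1%:E)).
rewrite [in RHS]muleA -!EFinM mulVf// mul1e => <-.
by congr EFin => /=; ring.
Qed.

Lemma integral_gauss_moment_abs k :
  (\int[mu]_x (`|x| ^+ k * gauss_fun x)%:E = (2 * half_gauss_moment k)%:E)%E.
Proof.
rewrite ge0_symfun_integralT.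
- rewrite EFinM -integral_half_gauss_moment; congr (_ * _)%E.
  rewrite -set_itvcy; apply: eq_integral => x; rewrite inE/= in_itv/= andbT => x0.
  by rewrite ger0_norm.
- by move=> x; rewrite mulr_ge0 ?exprn_ge0// gauss_fun_ge0.
- move=> x; apply: cvgM; last exact: continuous_gauss_fun.
  apply: (@continuous_comp _ _ _ (fun y : R => `|y|) (fun y => y ^+ k)).
    exact: norm_continuous.
  exact: exprn_continuous.
- by move=> x /=; rewrite normrN /gauss_fun sqrrN.
Qed.

(** The index [k.+2] makes the exponent of t equal to k/2 >= 0, so the integrand is the restriction
    of a function continuous at 0. *)
Lemma Gamma_half k :
  Gamma (k.+2%:R / 2 : R) = 2 * half_gauss_moment k.+1.
Proof.
(* Substitute t = x^2 on bounded intervals only: the library rule on the half *)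
(* line requires the derivative to have a finite limit at +oo.                *)
pose G (t : R) := Num.sqrt t ^+ k * expR (- t).
pose H (x : R) := 2 * (`|x| ^+ k.+1 * gauss_fun x).
have cG : continuous G.
  move=> t; apply: cvgM.
    apply: (@continuous_comp _ _ _ Num.sqrt (fun y => y ^+ k)).
      exact: sqrt_continuous.
    exact: exprn_continuous.
  by apply: (@continuous_comp _ _ _ -%R expR);
    [exact: continuousN|exact: continuous_expR].
have G0 t : 0 <= G t by rewrite mulr_ge0 ?exprn_ge0 ?expR_ge0.
have H0 x : 0 <= H x by rewrite !mulr_ge0 ?exprn_ge0 ?gauss_fun_ge0.
have mG := continuous_measurable_fun cG.
have mH : measurable_fun setT H.
  apply: measurable_funM => //; apply: measurable_funM; last exact: measurable_gauss_fun.
  by apply: measurable_funX; exact: normr_measurable.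
have dF : derive1 (fun x : R => x ^+ 2) = (fun x => 2 * x).
  by apply/funext => x; rewrite derive1E; have [_ ->] := is_derive_exprS 1 x.
have cdF : continuous (fun x : R => 2 * x).
  by move=> x; apply: cvgM; [exact: cvg_cst|exact: cvg_id].
have cF : continuous (fun x : R => x ^+ 2) by exact: exprn_continuous.
have subst n : (\int[mu]_(t in `[0%R, (n * n)%:R]) (G t)%:E =
    \int[mu]_(x in `[0%R, n%:R]) (H x)%:E)%E.
  have := @integration_by_substitution_increasing R (fun x => x ^+ 2) G 0 n%:R.
  rewrite expr0n/= natrM -expr2 => ->//.
  - apply: eq_integral => x; rewrite inE/= in_itv/= => /andP[x0 _]; congr EFin.
    rewrite !fctE dF.
    by rewrite /G /H /gauss_fun sqrtr_sqr ger0_norm// (exprS _ k); ring.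
  - move=> x y; rewrite !in_itv/= => /andP[x0 _] /andP[y0 _] xy.
    by rewrite ltrXn2r.
  - by rewrite dF => x _; exact: cdF.
  - by rewrite dF; apply/cvg_ex; eexists; exact/cvg_at_right_filter/cdF.
  - by rewrite dF; apply/cvg_ex; eexists; exact/cvg_at_left_filter/cdF.
  - split => [x _| |].
    + by have := is_derive_exprS 1 x; case.
    + exact/cvg_at_right_filter/cF.
    + exact/cvg_at_left_filter/cF.
  - exact: continuous_subspaceT.
have GH : (\int[mu]_(t in `[0%R, +oo[) (G t)%:E = \int[mu]_(x in `[0%R, +oo[) (H x)%:E)%E.
  have cvH := @ge0_cvgn_integral R mu _ H0 mH.
  have cvG := @ge0_cvgn_integral R mu _ G0 mG.
  (* Squaring maps [0, n] onto [0, n^2], so the integral of G is taken as a limit along the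
     squares. *)
  have n2y : (fun n => (n * n)%N) @ \oo --> \oo.
    apply/cvgnyPge => A; near=> n.
    have An : (A <= n)%N by near: n; exact: nbhs_infty_ge.
    by rewrite (leq_trans An)//; nia.
  have := cvg_comp _ _ n2y cvG.
  rewrite (_ : _ \o _ = (fun n => \int[mu]_(x in `[0%R, n%:R]) (H x)%:E)%E); last first.
    by apply/funext => n /=; exact: subst.
  by move=> /cvg_unique; apply.
rewrite /Gamma /Rintegral.
transitivity (fine (\int[mu]_(t in `[0%R, +oo[) (G t)%:E)%E).
  rewrite -integral_itv_obnd_cbnd; last exact/measurable_EFinP/measurable_funTS.
  congr fine; apply: eq_integral => t; rewrite inE/= in_itv/= andbT => t0.
  congr EFin; rewrite /G; congr (_ * _).
  rewrite -powR12_sqrt ?ltW// -powR_mulrn ?powR_ge0// -powRrM; congr (_ `^ _).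
  by rewrite -[in LHS]addn2 natrD mulrDl divff// addrK mulrC.
rewrite GH.
rewrite (_ : \int[mu]_(x in _) _ = (2 * half_gauss_moment k.+1)%:E)%E//.
rewrite EFinM -integral_half_gauss_moment -ge0_integralZl//.
- apply: eq_integral => x; rewrite inE/= in_itv/= andbT => x0.
  by rewrite /H ger0_norm.
- by apply/measurable_EFinP/measurable_funTS; exact: measurable_exprM_gauss.
- move=> x/=; rewrite in_itv/= andbT => x0.
  by rewrite lee_fin mulr_ge0 ?exprn_ge0// gauss_fun_ge0.
Unshelve. all: by end_near. Qed.

Lemma integral_power_tail n (r : R) : 0 < r ->
  (\int[mu]_(s in `[r, +oo[) (n.+1%:R * s ^- n.+2)%:E = (r ^- n.+1)%:E)%E.
Proof.
move=> r0; pose F (s : R) := - (s ^- n.+1).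
have dF (x : R) : 0 < x -> is_derive x 1 F (n.+1%:R * x ^- n.+2).
  move=> x0.
  have := @is_deriveV R (fun s => s ^+ n.+1) x _ 1 (lt0r_neq0 (exprn_gt0 _ x0))
    (is_derive_exprS n x).
  move=> /is_deriveN; rewrite /F /GRing.scale/= mulNr opprK.
  rewrite (_ : _ * (_ * _) = n.+1%:R * x ^- n.+2)// mulrCA; congr (_ * _).
  have xn0 : x != 0 by exact: lt0r_neq0.
  by rewrite !exprS; field; rewrite expf_neq0.
have F0 : F x @[x --> +oo] --> 0.
  rewrite -oppr0; apply: cvgN.
  have v0 : (x^-1 : R) @[x --> +oo] --> (0 : R).
    by apply/gtr0_cvgV0; [exact: nbhs_pinfty_gt|exact: cvg_id].
  have := cvg_comp _ (fun x : R => x ^+ n.+1) v0 (@exprn_continuous R n.+1 0).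
  rewrite expr0n/=; apply: cvg_trans; apply: near_eq_cvg; near=> x.
  by rewrite /= exprVn.
rewrite (@ge0_continuous_FTC2y _ _ F _ 0)//.
- by rewrite /F EFinN oppeK add0e.
- move=> x rx; rewrite mulr_ge0// invr_ge0 exprn_ge0// (le_trans (ltW r0))//.
- apply: continuous_in_subspaceT => x; rewrite inE/= in_itv/= andbT => rx.
  have x0 : 0 < x by exact: lt_le_trans rx.
  apply: cvgM; first exact: cvg_cst.
  apply: cvgV; first by rewrite expf_neq0 ?gt_eqF.
  exact: exprn_continuous.
- by move=> x rx; have := dF x (lt_trans r0 rx); case.
- apply: cvg_at_right_filter; apply: differentiable_continuous.
  by apply/derivable1_diffP; have := dF r r0; case.
- move=> x; rewrite in_itv/= andbT => rx; have := dF x (lt_trans r0 rx).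
  by rewrite derive1E => -[].
Unshelve. all: by end_near. Qed.

End gauss_moments.

(** * The surface measure as an image of volume *)

Section polar_coordinates.
Context {R : realType} {n : nat}.
Local Notation mu := (@lebesgue_measure R).
Local Notation leb := (lebesgue_tuple R n).
Local Notation sigma := (surface_measure R n).
Local Notation norm := (@euclidean_norm R n).
Implicit Types (x y : n.-tuple R).

(** The origin is written as a dilate of x so that homogeneity can be applied there. *)
Lemma euclidean_norm_eq0 x : norm x = 0 -> x = scale_tuple 0 x.
Proof.
move=> /eqP; rewrite sqrtr_eq0 => x0; apply: eq_from_tnth => i.
rewrite tnth_mktuple mul0r; apply/eqP; rewrite -sqrf_eq0 eq_le sqr_ge0 andbT.
apply: le_trans x0; rewrite (bigD1 i)//= lerDl.
by apply: sumr_ge0 => j _; exact: sqr_ge0.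
Qed.

Lemma measurable_scale_tuple (c : n.-tuple R -> R) : measurable_fun setT c ->
  measurable_fun setT (fun x => scale_tuple (c x) x).
Proof.
move=> mc; apply/measurable_fun_tnthP => i.
rewrite (_ : _ \o _ = fun x => c x * tnth x i); last first.
  by apply/funext => x /=; rewrite tnth_mktuple.
by apply: measurable_funM => //; exact: measurable_tnth.
Qed.

(* The value 0 sends the points outside the unit ball off the sphere, so that *)
(* [radial @^-1` A] lies in the punctured ball for A included in the sphere.  *)
Let normV x : R := if norm x <= 1 then (norm x)^-1 else 0.

Let radial x := scale_tuple (normV x) x.

Let normV_ge0 x : 0 <= normV x.
Proof. by rewrite /normV; case: ifP => // _; rewrite invr_ge0 norm_ge0. Qed.

Let measurable_normV : measurable_fun setT normV.
Proof.
apply: measurable_fun_ifT; last exact: measurable_cst.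
  by apply: measurable_fun_ler => //; exact: measurable_euclidean_norm.
rewrite (_ : (fun x => _) = fun x => norm x `^ (-1)); last first.
  by apply/funext => x; rewrite powR_inv1// norm_ge0.
exact: (measurableT_comp (measurable_powR _) (@measurable_euclidean_norm R n)).
Qed.

Let measurable_radial : measurable_fun setT radial.
Proof. exact: measurable_scale_tuple. Qed.

Let radial_sphere x : sphere R n (radial x) -> 0 < norm x <= 1.
Proof.
rewrite /sphere/= /radial norm_scale// /normV lt_neqAle norm_ge0 andbT.
case: ifP => _; last by rewrite mul0r => /esym/eqP; rewrite oner_eq0.
by case: eqVneq => // <-; rewrite mulr0 => /esym/eqP; rewrite oner_eq0.
Qed.

Let radialE x : 0 < norm x <= 1 -> radial x = scale_tuple (norm x `^ (-1)) x.
Proof.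
by move=> /andP[_ x1]; rewrite /radial /normV x1 powR_inv1// norm_ge0.
Qed.

(** On subsets of the sphere the surface measure is n times the image of volume under [radial],
    which opens the way to the change of variables for image measures. *)
Let surface_measureE A : A `<=` sphere R n ->
  sigma A = (n%:R%:E * leb (radial @^-1` A))%E.
Proof.
move=> AS; rewrite /surface_measure cone_sphereE; congr (_ * leb _)%E.
apply/seteqP; split => x /=; rewrite in_itv/=.
  by move=> [x1]; rewrite radialE.
move=> Ax; have x1 := radial_sphere _ (AS _ Ax).
by split => //; rewrite -radialE.
Qed.

Lemma ge0_integral_surface (Q : n.-tuple R -> \bar R) :
  measurable_fun setT Q -> (forall x, 0 <= Q x)%E ->
  (\int[sigma]_(x in sphere R n) Q x = n%:R%:E *
   \int[leb]_x (if (0 < norm x <= 1)%R then Q (scale_tuple (norm x)^-1%R x) else 0))%E.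
Proof.
move=> mQ Q0; have mS := @measurable_sphere R n.
have := @ge0_integral_pushforward _ _ _ _ R _ measurable_radial leb _ Q mS
  (measurable_funTS mQ) (fun x _ => Q0 x).
set I := (\int[_]_(x in _ @^-1` _) _)%E => pushE.
rewrite (_ : (\int[leb]_x _)%E = I); last first.
  rewrite /I (_ : _ @^-1` _ = [set x | 0 < norm x <= 1]).
    rewrite integral_mkcond_if; apply: eq_integral => x _; case: ifPn => // x1.
    by rewrite /= radialE// powR_inv1// norm_ge0.
  apply/seteqP; split => x /=; first exact: radial_sphere.
  move=> x1; rewrite /sphere/= radialE// norm_scale ?powR_ge0// powR_inv1 ?norm_ge0//.
  by rewrite mulVf// gt_eqF; case/andP: x1.
rewrite -pushE -(@ge0_integral_mscale _ _ _ _ _ mS (NngNum (ler0n R n)) Q)//; last exact: measurable_funTS.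
apply: eq_measure_integral => A mA AS.
by rewrite [LHS]surface_measureE.
Qed.

End polar_coordinates.

(** * The polar formula with Gaussian weight *)

Section polar_gauss.
Context {R : realType} {n0 m : nat}.
Local Notation mu := (@lebesgue_measure R).
Local Notation n := n0.+1.
Local Notation leb := (lebesgue_tuple R n).
Local Notation norm := (@euclidean_norm R n).
Implicit Types (x y : n.-tuple R).

(** For each fixed s > 0 two auxiliary integrands are matched by the dilation x = s y, so Tonelli
    and the scaling of volume suffice. The degree [m.+1] is positive, hence Q vanishes at the
    origin, as does the auxiliary integral over s there. *)
Lemma ge0_polar_gauss (Q : n.-tuple R -> R) :
  measurable_fun setT Q -> (forall x, 0 <= Q x) ->
  (forall t x, 0 <= t -> Q (scale_tuple t x) = t ^+ m.+1 * Q x) ->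
  (\int[leb]_x (Q x * gauss_fun (norm x))%:E =
   (half_gauss_moment (n0 + m.+1))%:E *
   \int[surface_measure R n]_(x in sphere R n) (Q x)%:E)%E.
Proof.
move=> mQ Q0 Qhom; set k := (n0 + m.+1)%N.
(* The cutoff lets the radial integral run over the whole line and makes [Phi] vanish for s <= 0. *)
pose g (u : R) := if 0 < u then u ^+ k * gauss_fun u else 0.
pose Qr x := Q (scale_tuple (norm x)^-1 x).
have mnorm := @measurable_euclidean_norm R n.
have mnormV : measurable_fun setT (fun x => (norm x)^-1).
  rewrite (_ : (fun x => _) = fun x => norm x `^ (-1)); last first.
    by apply/funext => x; rewrite powR_inv1// norm_ge0.
  exact: (measurableT_comp (measurable_powR _) mnorm).
have mQr : measurable_fun setT Qr.
  exact: (measurableT_comp mQ (measurable_scale_tuple _ mnormV)).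
have mg : measurable_fun setT g.
  apply: measurable_fun_ifT; last exact: measurable_cst.
    by apply: measurable_fun_ltr => //; exact: measurable_cst.
  exact: measurable_exprM_gauss.
have g0 u : 0 <= g u.
  rewrite /g; case: ifP => // /ltW u0.
  by rewrite mulr_ge0 ?exprn_ge0// gauss_fun_ge0.
have intg : (\int[mu]_x (g x)%:E = (half_gauss_moment k)%:E)%E.
  rewrite -integral_half_gauss_moment -integral_itv_obnd_cbnd; last first.
    by apply/measurable_EFinP/measurable_funTS; exact: measurable_exprM_gauss.
  rewrite integral_mkcond_if; apply: eq_integral => x _.
  by rewrite /g in_itv/= andbT; case: ifP.
have hk0 : 0 <= half_gauss_moment k :> R by exact/ltW/half_gauss_moment_gt0.
pose T := (measurableTypeR R * n.-tuple R)%type.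
have mfst : measurable_fun setT (fun p : T => p.1 : R) by exact: measurable_fst.
have msnd : measurable_fun setT (fun p : T => p.2) by exact: measurable_snd.
have mnorm2 : measurable_fun setT (fun p : T => norm p.2).
  exact: (measurableT_comp mnorm msnd).
(* With x = s y, Phi (s, y) = s^n Psi (s, x). Integrating Phi over s first    *)
(* gives the surface integral (the substitution r = s |y| produces the        *)
(* moment); integrating Psi over s first gives back Q x * gauss_fun (norm x), *)
(* as |x|^n * int_(s >= |x|) n s^-(n+1) ds = 1.                               *)
pose Phi (p : T) : \bar R := (if 0 < norm p.2 <= 1 then
  n%:R * (g (norm p.2 * p.1) * (norm p.2 * Qr p.2)) else 0)%:E.
pose Psi (p : T) : \bar R := (if 0 < norm p.2 <= p.1 then
  n%:R * p.1 ^- n.+1 * (norm p.2 ^+ n * (Q p.2 * gauss_fun (norm p.2))) else 0)%:E.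
have Phi0 p : (0 <= Phi p)%E.
  rewrite lee_fin; case: ifP => // _; rewrite mulr_ge0// mulr_ge0//.
  by rewrite mulr_ge0 ?norm_ge0// Q0.
have Psi0 p : (0 <= Psi p)%E.
  rewrite lee_fin; case: ifP => // /andP[p0 p1].
  rewrite !mulr_ge0 ?invr_ge0 ?exprn_ge0 ?norm_ge0 ?gauss_fun_ge0//.
  by rewrite (le_trans _ p1)// norm_ge0.
have mPhi : measurable_fun setT Phi.
  apply/measurable_EFinP; apply: measurable_fun_ifT; last exact: measurable_cst.
    apply: measurable_and; first exact: measurable_fun_ltr.
    exact: measurable_fun_ler.
  apply: measurable_funM; first exact: measurable_cst.
  apply: measurable_funM.
    by apply: (measurableT_comp mg); exact: measurable_funM.
  by apply: measurable_funM => //; exact: (measurableT_comp mQr msnd).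
have mPsi : measurable_fun setT Psi.
  apply/measurable_EFinP.
  (* The real power gives measurability; it agrees with the inverse where the condition holds, since
     p.1 > 0 there. *)
  rewrite (_ : (fun p : T => _) = fun p : T => if 0 < norm p.2 <= p.1 then
    n%:R * (p.1 `^ (-1)) ^+ n.+1 * (norm p.2 ^+ n * (Q p.2 * gauss_fun (norm p.2))) else 0); last first.
    apply/funext => p; case: ifP => // /andP[p0 p1].
    by rewrite powR_inv1 ?exprVn// (le_trans (ltW p0)).
  apply: measurable_fun_ifT; last exact: measurable_cst.
    apply: measurable_and; first exact: measurable_fun_ltr.
    exact: measurable_fun_ler.
  apply: measurable_funM.
    apply: measurable_funM; first exact: measurable_cst.
    apply: measurable_funX; exact: (measurableT_comp (measurable_powR _) mfst).
  apply: measurable_funM; first exact: measurable_funX.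
  apply: measurable_funM; first exact: (measurableT_comp mQ msnd).
  exact: (measurableT_comp measurable_gauss_fun mnorm2).
have intPhi y : (\int[mu]_s Phi (s, y) =
    (half_gauss_moment k)%:E * (n%:R%:E * (if (0 < norm y <= 1)%R then (Qr y)%:E else 0)))%E.
  rewrite /Phi/=; case: ifP => [/andP[y0 _]|_]; last by rewrite integral0 !mule0.
  transitivity (\int[mu]_s ((n%:R * (norm y * Qr y))%:E * (g (norm y * s))%:E))%E.
    by apply: eq_integral => s _; rewrite -EFinM; congr EFin; ring.
  have mge : measurable_fun setT (fun s => (g s)%:E) by exact/measurable_EFinP.
  rewrite ge0_integralZl//; last 3 first.
  - apply: (measurableT_comp mge); exact: mulrl_measurable.
  - by move=> s _; rewrite lee_fin.
  - by rewrite lee_fin mulr_ge0// mulr_ge0 ?norm_ge0// Q0.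
  have ny : norm y != 0 by rewrite gt_eqF.
  rewrite (ge0_integral_scale _ (fun s => (g s)%:E) ny mge (fun s => g0 s)).
  rewrite intg -!EFinM gtr0_norm//; congr EFin.
  by field.
have intPsi x : (\int[mu]_s Psi (s, x) = (Q x * gauss_fun (norm x))%:E)%E.
  rewrite /Psi/=; have := norm_ge0 x; rewrite le_eqVlt => /predU1P[/esym x0|x0].
    rewrite x0 ltxx/= integral0 (euclidean_norm_eq0 _ x0) Qhom// expr0n/=.
    by rewrite !mul0r.
  pose c := norm x ^+ n * (Q x * gauss_fun (norm x)).
  have c0 : 0 <= c by rewrite !mulr_ge0 ?exprn_ge0 ?norm_ge0 ?gauss_fun_ge0.
  transitivity (c%:E * \int[mu]_(s in `[norm x, +oo[) (n%:R * s ^- n.+1)%:E)%E; last first.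
    rewrite integral_power_tail// -EFinM; congr EFin; rewrite /c.
    by field; rewrite expf_neq0 ?gt_eqF.
  have mtail : measurable_fun `[norm x, +oo[%classic
      (fun s : R => (n%:R * s ^- n.+1)%:E).
    apply: (@eq_measurable_fun _ _ _ _ _ (fun s : R => (n%:R * (s `^ (-1)) ^+ n.+1)%:E)).
      move=> s; rewrite inE/= in_itv/= andbT => xs.
      by rewrite powR_inv1 ?exprVn// (le_trans (ltW x0)).
    apply/measurable_EFinP; apply: measurable_funM => //.
    by apply: measurable_funX; apply: measurable_funTS; exact: measurable_powR.
  rewrite -ge0_integralZl//; last first.
  - move=> s/=; rewrite in_itv/= andbT => xs; rewrite lee_fin.
    by rewrite mulr_ge0// invr_ge0 exprn_ge0// (le_trans _ xs)// ltW.
  rewrite integral_mkcond_if; apply: eq_integral => s _.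
  by rewrite in_itv/= andbT x0/=; case: ifP => // _; rewrite -EFinM mulrC.
rewrite ge0_integral_surface; last 2 first.
- exact/measurable_EFinP.
- by move=> x; rewrite lee_fin.
have mif : measurable_fun setT
    (fun y => if 0 < norm y <= 1 then (Qr y)%:E else 0%E).
  apply: measurable_fun_ifT; last exact: measurable_cst.
    apply: measurable_and; first exact: measurable_fun_ltr.
    exact: measurable_fun_ler.
  exact/measurable_EFinP.
have if0 y : (0 <= if (0 < norm y <= 1)%R then (Qr y)%:E else 0)%E.
  by case: ifP => // _; rewrite lee_fin Q0.
transitivity (\int[leb]_y \int[mu]_s Phi (s, y))%E; last first.
  under eq_integral do rewrite intPhi.
  rewrite ge0_integralZl//.
  - rewrite ge0_integralZl//.
  - by apply: measurable_funeM.
  - by move=> y _; rewrite mule_ge0.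
rewrite -(fubini_tonelli Phi mPhi Phi0).
under eq_integral do rewrite -intPsi.
rewrite -(fubini_tonelli Psi mPsi Psi0).
suff PhiPsi (s : R) : (\int[leb]_y Phi (s, y) = \int[leb]_x Psi (s, x))%E.
  by apply: eq_integral => s _; rewrite PhiPsi.
have [s0|s0] := leP s 0.
  rewrite (@integral0_eq _ _ _ _ _ (fun y => Phi (s, y))); last first.
    move=> x _; rewrite /Phi/=; case: ifP => // /andP[x0 _].
    by rewrite /g ltNge pmulr_rle0// s0/= mul0r mulr0.
  rewrite integral0_eq// => x _; rewrite /Psi/= ifF//; apply/negbTE.
  by rewrite negb_and -leNgt -ltNge; case: (leP (norm x) 0) => //= x0; exact: le_lt_trans x0.
(* The factor s^n is the Jacobian of x = s y; it cancels the s^-n produced by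
   [ge0_integral_scale_coords]. *)
pose G x : \bar R := ((s ^+ n)%:E * Psi (s, x))%E.
have mG : measurable_fun setT G.
  by apply: measurable_funeM; exact: (measurableT_comp mPsi (measurable_pair1 s)).
have G0 x : (0 <= G x)%E by rewrite mule_ge0// lee_fin exprn_ge0// ltW.
have sn0 : s != 0 by rewrite gt_eqF.
transitivity (\int[leb]_x G (scale_coords n (fun=> s) x))%E.
  apply: eq_integral => y _; rewrite /G /Phi /Psi/= -EFinM.
  rewrite -[scale_coords n _ y]/(scale_tuple s y) (norm_scale _ (ltW s0)).
  rewrite pmulr_rgt0//.
  have -> : (s * norm y <= s) = (norm y <= 1) by rewrite -[leRHS]mulr1 ler_pM2l.
  congr EFin.
  case: ifP => [/andP[y0 y1]|]; last by rewrite mulr0.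
  (* Both sides reduce to n s^(n0+m+1) |y|^n Q(y) exp(-s^2 |y|^2). *)
  rewrite /g mulr_gt0// (Qhom _ _ (ltW s0)) /Qr Qhom ?invr_ge0 ?norm_ge0//.
  rewrite [norm y * s]mulrC /k !exprMn exprVn !exprD !exprS.
  have yn0 : norm y != 0 by rewrite gt_eqF.
  by field; rewrite sn0 yn0 !expf_neq0.
rewrite ge0_integral_scale_coords// ge0_integralZl//; last 2 first.
- exact: (measurableT_comp mPsi (measurable_pair1 s)).
- by rewrite lee_fin exprn_ge0// ltW.
rewrite muleA -EFinM prodr_const card_ord gtr0_norm// exprVn mulVf ?expf_neq0//.
by rewrite mul1e.
Qed.

End polar_gauss.

(** * Monomial integrals over the sphere *)

Section sphere_monomials.
Context {R : realType} {n0 : nat}.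
Local Notation n := n0.+1.
Local Notation leb := (lebesgue_tuple R n).
Local Notation sigma := (surface_measure R n).
Local Notation norm := (@euclidean_norm R n).
Implicit Types (x : n.-tuple R) (nu : 'I_n -> nat).

Lemma gauss_fun_norm x : gauss_fun (norm x) = \prod_(i < n) gauss_fun (tnth x i).
Proof.
rewrite /gauss_fun /euclidean_norm sqr_sqrtr; last first.
  by apply: sumr_ge0 => i _; exact: sqr_ge0.
by rewrite -sumrN expR_sum.
Qed.

Definition monomial nu x : R := \prod_(i < n) tnth x i ^+ nu i.

Lemma measurable_monomial nu : measurable_fun setT (monomial nu).
Proof.
by apply: measurable_prod => i _; apply: measurable_funX; exact: measurable_tnth.
Qed.

Lemma monomial_scale nu t x :
  monomial nu (scale_tuple t x) = t ^+ (\sum_i nu i) * monomial nu x.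
Proof.
rewrite /monomial -prodrXr -big_split/=; apply: eq_bigr => i _.
by rewrite tnth_mktuple exprMn.
Qed.

Section positive_degree.
Variables (nu : 'I_n -> nat) (m : nat).
Hypothesis nu_deg : (\sum_i nu i)%N = m.+1.
Local Notation c := (half_gauss_moment (n0 + m.+1) : R).

Let absM x := `|monomial nu x|.

Let measurable_absM : measurable_fun setT absM.
Proof. exact: (measurableT_comp (@normr_measurable R setT) (measurable_monomial nu)). Qed.

Let absM_scale t x : 0 <= t -> absM (scale_tuple t x) = t ^+ m.+1 * absM x.
Proof.
move=> t0; rewrite /absM monomial_scale nu_deg normrM.
by rewrite (ger0_norm (exprn_ge0 _ t0)).
Qed.

(** The absolute value makes the polar formula applicable for every parity of nu, so this gives both
    the even integrals and the integrability of all monomials of positive degree. *)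
Lemma integral_sphere_norm_monomial :
  (\int[sigma]_(x in sphere R n) `|monomial nu x|%:E =
   (\prod_(i < n) (2 * half_gauss_moment (nu i)) / c)%:E)%E.
Proof.
have c0 : 0 < c := half_gauss_moment_gt0 _.
have := @ge0_polar_gauss R n0 m absM measurable_absM (fun x => normr_ge0 _) absM_scale.
under eq_integral => x _.
  rewrite /absM /monomial normr_prod gauss_fun_norm -big_split/=.
  under eq_bigr do rewrite normrX.
  over.
rewrite (@ge0_integral_lebesgue_tuple_prod R n (fun i y => `|y| ^+ nu i * gauss_fun y)
  (fun i => 2 * half_gauss_moment (nu i))); first last.
- by move=> i; exact: integral_gauss_moment_abs.
- by move=> i y; rewrite mulr_ge0 ?exprn_ge0 ?gauss_fun_ge0.
- move=> i; apply: measurable_funM; last exact: measurable_gauss_fun.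
  by apply: measurable_funX; exact: normr_measurable.
move=> /(congr1 (mule c^-1%:E)).
rewrite muleA -!EFinM mulVf ?gt_eqF// mul1e => <-.
by rewrite mulrC.
Qed.

Lemma integrable_sphere_monomial :
  sigma.-integrable (sphere R n) (EFin \o monomial nu).
Proof.
apply/integrableP; split.
  by apply/measurable_EFinP/measurable_funTS; exact: measurable_monomial.
rewrite (eq_integral (fun x => `|monomial nu x|%:E)).
  by rewrite integral_sphere_norm_monomial ltry.
by [].
Qed.

Lemma Rintegral_sphere_even : (forall i, ~~ odd (nu i)) ->
  \int[sigma]_(x in sphere R n) monomial nu x =
  \prod_(i < n) (2 * half_gauss_moment (nu i)) / c.
Proof.
move=> nu_even; rewrite /Rintegral -[RHS]/(fine _%:E) -integral_sphere_norm_monomial.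
congr fine; apply: eq_integral => x _; congr EFin; rewrite ger0_norm//.
by apply: prodr_ge0 => i _; rewrite exprn_even_ge0.
Qed.

(** Reflecting coordinate i negates the monomial. As the polar formula takes nonnegative integrands,
    the argument runs on |x^nu| - x^nu and |x^nu| + x^nu; equality of their integrals forces that of
    x^nu to be 0. *)
Lemma Rintegral_sphere_odd i : odd (nu i) ->
  \int[sigma]_(x in sphere R n) monomial nu x = 0.
Proof.
move=> nui.
have c0 : 0 < c := half_gauss_moment_gt0 _.
pose s (b : bool) x := absM x + (-1) ^+ b * monomial nu x.
have s0 b x : 0 <= s b x.
  rewrite /s /absM; case: b; rewrite ?expr0 ?mul1r ?expr1 ?mulN1r.
    by rewrite subr_ge0 ler_norm.
  by rewrite -[X in _ + X]opprK subr_ge0 -normrN ler_norm.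
have ms b : measurable_fun setT (s b).
  apply: measurable_funD => //; apply: measurable_funM => //.
  exact: measurable_monomial.
have s_scale b t x : 0 <= t -> s b (scale_tuple t x) = t ^+ m.+1 * s b x.
  by move=> t0; rewrite /s absM_scale// monomial_scale nu_deg; ring.
have polar b := @ge0_polar_gauss R n0 m (s b) (ms b) (s0 b) (s_scale b).
(* The reflection is a coordinate scaling by factors of absolute value 1, so it preserves volume and
   norm. *)
pose a (j : 'I_n) : R := if j == i then -1 else 1.
have norm_a j : `|a j| = 1 by rewrite /a; case: ifP => _; rewrite ?normrN1 ?normr1.
have refl_norm x : norm (scale_coords n a x) = norm x.
  rewrite /euclidean_norm; congr Num.sqrt; apply: eq_bigr => j _.
  by rewrite tnth_mktuple exprMn -(real_normK (num_real (a j))) norm_a expr1n mul1r.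
have refl_monomial x : monomial nu (scale_coords n a x) = - monomial nu x.
  rewrite /monomial (bigD1 i)//= [in RHS](bigD1 i)//= tnth_mktuple /a eqxx mulN1r.
  rewrite exprNn -signr_odd nui mulN1r mulNr; congr (- (_ * _)).
  by apply: eq_bigr => j ji; rewrite tnth_mktuple (negbTE ji) mul1r.
have refl_s b x : s b (scale_coords n a x) = s (~~ b) x.
  by rewrite /s /absM refl_monomial normrN; case: b; rewrite /= ?expr0 ?expr1; ring.
(* The reflection in coordinate i exchanges |x^nu| - x^nu and |x^nu| + x^nu. *)
have sE : (\int[sigma]_(x in sphere R n) (s true x)%:E =
    \int[sigma]_(x in sphere R n) (s false x)%:E)%E.
  have : (c%:E * \int[sigma]_(x in sphere R n) (s true x)%:E =
      c%:E * \int[sigma]_(x in sphere R n) (s false x)%:E)%E.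
    rewrite -!polar.
    have := @ge0_integral_scale_coords R n a (fun x => (s true x * gauss_fun (norm x))%:E).
    rewrite big1 ?mul1e => [<-|j _]; last by rewrite norm_a invr1.
    - by apply: eq_integral => x _; rewrite refl_s refl_norm.
    - by move=> j; rewrite -normr_eq0 norm_a oner_eq0.
    - apply/measurable_EFinP; apply: measurable_funM => //.
      exact: (measurableT_comp measurable_gauss_fun (@measurable_euclidean_norm R n)).
    - by move=> x; rewrite lee_fin mulr_ge0// gauss_fun_ge0.
  move=> /(congr1 (mule c^-1%:E)).
  by rewrite !muleA -!EFinM mulVf ?gt_eqF// !mul1e.
have iM := integrable_sphere_monomial.
have iA : sigma.-integrable (sphere R n) (EFin \o absM).
  exact: (integrable_abse iM).
have mS := @measurable_sphere R n.
have : \int[sigma]_(x in sphere R n) (absM x - monomial nu x) =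
    \int[sigma]_(x in sphere R n) (absM x + monomial nu x).
  rewrite /Rintegral; move/(congr1 fine) : sE.
  rewrite (_ : s true = fun x => absM x - monomial nu x).
    rewrite (_ : s false = fun x => absM x + monomial nu x)//.
    by apply/funext => x; rewrite /s mul1r.
  by apply/funext => x; rewrite /s mulN1r.
rewrite RintegralB// RintegralD//; lra.
Qed.

End positive_degree.

End sphere_monomials.

(** * Combinatorics of Psi *)

(** At s = 0 the integer -1 is traded for the truncated predecessor 0; both double factorials are
    1. *)
Lemma double_fact_eta (s : nat) :
  double_fact (eta s) = double_fact_nat (if odd s then s else s.-1).
Proof.
rewrite /eta; case: ifP => //; case: s => [|s _]//.
by rewrite (_ : (s.+1%:Z - 1)%R = s%:Z)//; lia.
Qed.

(** All nu_k are even exactly when the odd positions of mu form the symmetric difference of {i} and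
    {j}: none if i = j, and {i, j} otherwise. These are the nonzero entries of the two matrix
    cases. *)
Lemma Psi_entry n (mu : multinom n) (i j : 'I_n)
    (nu := fun k => (mu k + (k == i) + (k == j))%N) :
  Psi mu i j = if [forall k, ~~ odd (nu k)]
    then (\prod_(k < n) double_fact_nat (nu k).-1)%N else 0%N.
Proof.
rewrite /Psi mxE; case: ifPn => [nu_odd|].
  under eq_bigr do rewrite double_fact_eta.
  have mu_odd k : odd (mu k) = ((k == i) (+) (k == j)).
    have := forallP nu_odd k; rewrite /nu !oddD !oddb.
    by case: (odd _); case: (k == i); case: (k == j).
  case: (eqVneq i j) => [ij|ij].
    have mu_even k : odd (mu k) = false by rewrite mu_odd ij addbb.
    rewrite (_ : enum _ = [::]); last first.
      by apply/eqP; rewrite -size_eq0 -cardE; apply/pred0P => k /=; rewrite mu_even.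
    rewrite !mxE -ij eqxx/= mulr1n (bigD1 i)//= [RHS](bigD1 i)//=.
    rewrite (eq_bigr (fun k => double_fact_nat (nu k).-1)); last first.
      by move=> k ki; rewrite mu_even /nu -ij (negbTE ki) !addn0.
    rewrite mu_even /nu -ij eqxx !addn1.
    (* The diagonal entry mu_i + 1 raises (mu_i - 1)!! to (mu_i + 1)!! = (nu_i - 1)!!. *)
    have -> : double_fact_nat (mu i).+2.-1 = ((mu i).+1 * double_fact_nat (mu i).-1)%N.
      by case: (mu i) => [|[|l]].
    rewrite -[LHS]/(_ * (mu i + 1))%N addn1; lia.
  have : perm_eq (enum [pred k | odd (mu k)]) [:: i; j].
    apply: uniq_perm; rewrite ?enum_uniq//=; first by rewrite inE ij.
    move=> k; rewrite mem_enum !inE mu_odd.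
    by case: (eqVneq k i) => [->|_]; rewrite ?(negbTE ij).
  rewrite (eq_bigr (fun k => double_fact_nat (nu k).-1)); last first.
    (* At i and j, mu_k is odd and nu_k - 1 = mu_k; elsewhere mu_k is even and nu_k = mu_k. *)
    move=> k _; rewrite mu_odd /nu; case: (eqVneq k i) => [->|ki].
      by rewrite (negbTE ij)/= addn0 addn1.
    by rewrite addn0; case: (k == j); rewrite ?addn1 ?addn0.
  move=> /(fun p => (perm_size p, perm_mem p))[]; case: (enum _) => [|u [|v [|]]]// _ mem_uv.
  rewrite !mxE !big_ord1 !mxE/= !eqxx !andbT.
  have := mem_uv i; have := mem_uv j; rewrite !inE !eqxx ?orbT/=.
  have ji : j != i by rewrite eq_sym.
  move=> /orP[/eqP ju|/eqP jv] /orP[/eqP iu|/eqP iv].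
  - by move: ij; rewrite iu ju eqxx.
  - by rewrite -ju -iv !eqxx (negbTE ij) mul0r add0r !mulr1.
  - by rewrite -jv -iu !eqxx (negbTE ji) mulr0 addr0 !mulr1.
  - by move: ij; rewrite iv jv eqxx.
rewrite negb_forall => /existsP[k0]; rewrite negbK => k0_odd.
have Psi0 : ~ (forall k, odd (mu k) = ((k == i) (+) (k == j))).
  move=> /(_ k0) mu_k0; move: k0_odd; rewrite /nu !oddD !oddb mu_k0.
  by case: (_ == i); case: (_ == j).
have mem_odd k : (k \in enum [pred k | odd (mu k)]) = odd (mu k) by rewrite mem_enum.
case: (enum _) (enum_uniq [pred k | odd (mu k)]) mem_odd =>
  [|u [|v [|w s]]] uniq_s mem_odd; try by rewrite mxE mulr0.
  rewrite !mxE; case: (eqVneq i j) => ij; last by rewrite mulr0n addr0 mulr0.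
  by case: Psi0 => k; rewrite ij addbb -mem_odd in_nil.
rewrite !mxE !big_ord1 !mxE/= !eqxx !andbT.
have odd_uv k : odd (mu k) = ((k == u) (+) (k == v)).
  rewrite -mem_odd !inE; case: (eqVneq k u) => // ->.
  by move: uniq_s; rewrite /= inE andbT => /negbTE ->.
have iujv : (i == u) && (j == v) = false.
  by apply/negP => /andP[/eqP iu /eqP jv]; apply: Psi0 => k; rewrite iu jv.
have ivju : (i == v) && (j == u) = false.
  by apply/negP => /andP[/eqP iv /eqP ju]; apply: Psi0 => k; rewrite iv ju addbC.
by rewrite -!natrM !mulnb iujv ivju addr0 mulr0.
Qed.

(** * Assembling the covariance matrix *)

Section covariance.
Context {R : realType}.

Lemma half_gauss_moment_even k : ~~ odd k ->
  2 * half_gauss_moment k =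
  (double_fact_nat k.-1)%:R / 2 ^+ k./2 * Num.sqrt pi :> R.
Proof.
move=> k_even; have [a ->] : exists a, k = a.*2.
  by exists k./2; rewrite even_halfK.
rewrite doubleK; elim: a => [|a ih].
  by rewrite /= expr0 divr1 mul1r mulrC divfK.
have df : double_fact_nat a.+1.*2.-1 = (a.*2.+1 * double_fact_nat a.*2.-1)%N.
  by case: a {ih}.
rewrite df natrM doubleS/= mulrCA ih exprS; field.
by rewrite expf_neq0.
Qed.

Lemma monomial_mul_coords n0 (mu : 'I_n0.+1 -> nat) (i j : 'I_n0.+1)
    (x : n0.+1.-tuple R) :
  monomial (fun k => (mu k + (k == i) + (k == j))%N) x =
  \prod_k tnth x k ^+ mu k * (tnth x i * tnth x j).
Proof.
have coord l : \prod_k tnth x k ^+ (k == l) = tnth x l.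
  rewrite (bigD1 l)//= eqxx expr1 big1 ?mulr1// => k kl.
  by rewrite (negbTE kl).
rewrite /monomial; under [LHS]eq_bigr do rewrite !exprD.
by rewrite !big_split/= !coord mulrA.
Qed.

(** In the even case the halved exponents sum to d+1, giving 2^-(d+1); dividing by the radial moment
    Gamma(n/2+d+1)/2 restores one factor 2, which leaves 2^d. *)
Lemma Rintegral_sphere_monomial n0 d (nu : 'I_n0.+1 -> nat) :
  (\sum_k nu k)%N = (2 * d + 2)%N ->
  \int[surface_measure R n0.+1]_(x in sphere R n0.+1) monomial nu x =
  (pi `^ (n0.+1%:R / 2) / (2 ^+ d * Gamma (n0.+1%:R / 2 + d%:R + 1))) *
  (if [forall k, ~~ odd (nu k)]
   then (\prod_(k < n0.+1) double_fact_nat (nu k).-1)%N else 0%N)%:R.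
Proof.
move=> nu_deg; have nu_deg' : (\sum_k nu k)%N = (2 * d).+2 by rewrite nu_deg addn2.
case: ifPn => [/forallP nu_even|]; last first.
  rewrite negb_forall => /existsP[k]; rewrite negbK => /(Rintegral_sphere_odd _ _ nu_deg') ->.
  by rewrite mulr0.
rewrite (Rintegral_sphere_even _ _ nu_deg')//.
under eq_bigr do rewrite half_gauss_moment_even//.
rewrite !big_split/= prodr_const card_ord prodfV prodrXr natr_prod.
have -> : (\sum_k (nu k)./2 = d.+1)%N.
  apply: double_inj; rewrite -muln2 big_distrl/=.
  under eq_bigr do rewrite muln2 even_halfK//.
  by rewrite nu_deg'; lia.
have -> : Num.sqrt (pi : R) ^+ n0.+1 = pi `^ (n0.+1%:R / 2).
  by rewrite -powR12_sqrt ?pi_ge0// -powR_mulrn ?powR_ge0// -powRrM mulrC.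
have -> : n0.+1%:R / 2 + d%:R + 1 = (n0 + (2 * d).+1).+2%:R / 2 :> R.
  by rewrite !mulrSr natrD mulrSr natrM; field.
rewrite Gamma_half addnS exprS.
have h0 := half_gauss_moment_gt0 (R := R) (n0 + (2 * d).+1).+1.
by field; rewrite gt_eqF// expf_neq0.
Qed.

End covariance.

Theorem theorem11 (R : realType) (n d : nat) (f : mpoly n R)
    (n_gt0 : (0 < n)%N) (f_homog : f \is ishomog1 d mdeg) :
  cov f =
    (pi `^ (n%:R / 2) / (2 ^+ d * Gamma (n%:R / 2 + d%:R + 1))) *:
    \sum_(mu <- msupp (f ^+ 2))
       mcoeff mu (f ^+ 2) *: map_mx (fun k : nat => k%:R) (Psi mu).
Proof.
case: n f n_gt0 f_homog => // n0 f _ f_homog.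
have f2_homog : f ^+ 2 \is ishomog1 (2 * d) mdeg.
  by rewrite expr2 mul2n -addnn; exact: dhomogM.
set C := _ / (_ * Gamma _).
apply/matrixP => i j; rewrite !mxE summxE mulr_sumr.
pose nu (mu : multinom n0.+1) k := (mu k + (k == i) + (k == j))%N.
have nu_deg mu : (\sum_k nu mu k)%N = (mdeg mu).+2.
  have delta (l : 'I_n0.+1) : (\sum_k (k == l) = 1)%N.
    by rewrite (bigD1 l)//= eqxx big1// => k /negbTE ->.
  by rewrite !big_split/= !delta mdegE !addn1.
pose sigma := surface_measure R n0.+1.
(* The two extra coordinates make the degree positive even when mu = 0. *)
have iM mu : sigma.-integrable (sphere R n0.+1) (EFin \o monomial (nu mu)).
  exact: integrable_sphere_monomial (nu_deg mu).
pose F mu x := mcoeff mu (f ^+ 2) * monomial (nu mu) x.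
have iF mu : sigma.-integrable (sphere R n0.+1) (EFin \o F mu).
  exact: (integrableZl (@measurable_sphere R n0.+1) (mcoeff mu (f ^+ 2)) (iM mu)).
have FE x : meval (tnth x) f ^+ 2 * (tnth x i * tnth x j) =
    \sum_(mu <- msupp (f ^+ 2)) F mu x.
  rewrite expr2 -mevalM -expr2 mevalE mulr_suml; apply: eq_bigr => mu _.
  by rewrite /F monomial_mul_coords -mulrA.
transitivity (\sum_(mu <- msupp (f ^+ 2)) \int[sigma]_(x in sphere R n0.+1) F mu x).
  rewrite /Rintegral.
  under eq_integral do rewrite FE -sumEFin.
  rewrite (integral_sum (@measurable_sphere R n0.+1) iF).
  rewrite (eq_bigr (fun mu => (fine (\int[sigma]_(x in sphere R n0.+1) (F mu x)%:E)%E)%:E)).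
    by rewrite sumEFin.
  move=> mu _; rewrite fineK//; exact: (integrable_fin_num (@measurable_sphere R n0.+1) (iF mu)).
(* Membership in the support is kept because homogeneity of f^2 then gives mu degree 2d. *)
apply: eq_big_seq => mu mu_supp.
rewrite mxE [map_mx _ _ _ _]mxE Psi_entry RintegralZl//; last exact: measurable_sphere.
rewrite (Rintegral_sphere_monomial _ d); first by rewrite -/C mulrCA.
by rewrite nu_deg addn2 (dhomog_mf f2_homog mu_supp).
Qed.
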